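(* Let $L\subseteq \mathrm{Fm}(\Box)$ be a normal unimodal logic that is canonical and such that the class of its frames $\mathsf{Fr}(L)$ admits definable filtration. Then: (1) the class of models $\mathsf{Mod}(L^{\boxplus})$ admits definable filtration; (2) hence the logic $L^{\boxplus}$ has the finite model property; (3) hence the logic $L^{\boxplus}$ is Kripke complete.
   Context: Formulas. For a finite alphabet $\Sigma$ of indices, $\mathrm{Fm}(\Sigma)$ is the set of modal formulas built from propositional variables $p_0,p_1,\dots$ using $\bot$, $\to$ and unary modalities $[e]$, $e\in\Sigma$. In the unimodal case the modality is $\Box$; in the bimodal language $\mathrm{Fm}(\Box,\boxplus)$ there are two modalities $\Box,\boxplus$. A set $\Gamma$ of formulas is Sub-closed if it contains all subformulas of its members. Semantics. A ($\Sigma$-)frame is $F=(W,(R_e)_{e\in\Sigma})$ with $W\neq\varnothing$ and $R_e\subseteq W\times W$; a model on $F$ is $M=(F,V)$ with $V(p)\subseteq W$ for each variable $p$. Truth $M,x\models\varphi$ is standard ($M,x\models[e]\varphi$ iff $M,y\models\varphi$ for all $y$ with $xR_ey$). $M\models\varphi$ means truth at all points; $F\models\varphi$ means $M\models\varphi$ for all models $M$ on $F$. A (normal) logic over $\Sigma$ is a set of $\Sigma$-formulas containing all classical tautologies and all $[e](p\to q)\to([e]p\to[e]q)$, closed under modus ponens, substitution and necessitation. $\mathsf{Mod}(L)$ is the class of all models $M$ with $M\models L$; $\mathsf{Fr}(L)$ is the class of all frames $F$ with $F\models L$. A logic is Kripke complete if it is the set of all formulas valid in some class of frames; it has the finite model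 property if it is the set of all formulas valid in some class of finite frames. Canonicity. The canonical frame $F_L=(W_L,R_L)$ of a (consistent) normal unimodal logic $L$ has as points all consistent complete sets of formulas containing $L$ and closed under modus ponens (i.e. maximal $L$-consistent sets), with $x R_L y$ iff for every formula $A$, $\Box A\in x$ implies $A\in y$. $L$ is canonical if $F_L\models L$. The logic $L^{\boxplus}$. For a normal unimodal logic $L\subseteq\mathrm{Fm}(\Box)$, $L^{\boxplus}\subseteq\mathrm{Fm}(\Box,\boxplus)$ is the smallest normal logic containing $L$ and the axioms $\boxplus p\to\Box p$, $\ \boxplus p\to\Box\boxplus p$, $\ \boxplus(p\to\Box p)\to(\Box p\to\boxplus p)$. Filtration. Let $M=(W,(R_e)_{e\in\Sigma},V)$ be a model. For a set $\Phi$ of formulas, $x\sim_\Phi y$ iff for all $\varphi\in\Phi$: $M,x\models\varphi\Leftrightarrow M,y\models\varphi$. Let $\Gamma$ be a finite Sub-closed set of formulas. A $\Gamma$-filtration of $M$ is a model $\widehat M=(\widehat W,(\widehat R_e)_{e\in\Sigma},\widehat V)$ such that: $\widehat W=W/{\sim}$ for some equivalence relation $\sim$ on $W$ with finitely many classes and with $\sim\,\subseteq\,\sim_\Gamma$; for all variables $p\in\Gamma$ and $x\in W$, $\widehat M,\widehat x\models p$ iff $M,x\models p$, where $\widehat x$ is the $\sim$-class of $x$; and for each $e\in\Sigma$, $R^{\min}_{\sim,e}\subseteq\widehat R_e\subseteq R^{\max}_{\Gamma,e}$, where $\widehat x\,R^{\min}_{\sim,e}\,\widehat y$ iff there are $x'\sim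 x$, $y'\sim y$ with $x'R_ey'$, and $\widehat x\,R^{\max}_{\Gamma,e}\,\widehat y$ iff for every formula $[e]\varphi\in\Gamma$, $M,x\models[e]\varphi$ implies $M,y\models\varphi$. The filtration is definable if $\sim\,=\,\sim_\Phi$ for some finite set of formulas $\Phi$. A class of models $\mathcal M$ admits definable filtration if for every finite Sub-closed set of formulas $\Gamma$ and every $M\in\mathcal M$ there is a model in $\mathcal M$ that is a definable $\Gamma$-filtration of $M$. A class of frames $\mathcal F$ admits definable filtration if for every finite Sub-closed $\Gamma$ and every model $M$ based on a frame from $\mathcal F$ there is a model based on a frame from $\mathcal F$ that is a definable $\Gamma$-filtration of $M$. *)

(* Defs.v *)
From Stdlib Require Import RelationClasses.
From mathcomp Require Import all_boot.
From mathcomp Require Import boolp classical_sets cardinality.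

Set Implicit Arguments.
Unset Strict Implicit.
Unset Printing Implicit Defensive.

Local Open Scope classical_set_scope.

Inductive form (S : Type) : Type :=
| Var (p : nat)
| Bot
| Imp (A B : form S)
| Box (e : S) (A : form S).

Arguments Var {S} p.
Arguments Bot {S}.

Definition Neg (S : Type) (A : form S) : form S := Imp A Bot.

Fixpoint subst (S : Type) (s : nat -> form S) (A : form S) : form S :=
  match A with
  | Var p => s p
  | Bot => Bot
  | Imp A B => Imp (subst s A) (subst s B)
  | Box e A => Box e (subst s A)
  end.

Fixpoint rename_modality (S S' : Type) (f : S -> S') (A : form S) : form S' :=
  match A with
  | Var p => Var p
  | Bot => Bot
  | Imp A B => Imp (rename_modality f A) (rename_modality f B)
  | Box e A => Box (f e) (rename_modality f A)
  end.

Fixpoint subformula (S : Type) (B A : form S) : Prop :=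
  B = A \/
  match A with
  | Var _ | Bot => False
  | Imp A1 A2 => subformula B A1 \/ subformula B A2
  | Box _ A1 => subformula B A1
  end.

Definition sub_closed (S : Type) (G : set (form S)) : Prop :=
  forall A B : form S, G A -> subformula B A -> G B.

Record frame (S : Type) : Type := Frame {
  world : Type;
  world_nonempty : inhabited world;
  acc : S -> world -> world -> Prop
}.

Record model (S : Type) : Type := Model {
  frame_of : frame S;
  valuation : nat -> world frame_of -> Prop
}.

Arguments valuation {S} m p x.

Fixpoint sat (S : Type) (M : model S) (x : world (frame_of M)) (A : form S)
    : Prop :=
  match A with
  | Var p => valuation M p x
  | Bot => False
  | Imp A B => sat x A -> sat x B
  | Box e A => forall y, acc e x y -> sat y A
  end.

Definition model_valid (S : Type) (M : model S) (A : form S) : Prop :=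
  forall x : world (frame_of M), sat x A.

Definition frame_valid (S : Type) (F : frame S) (A : form S) : Prop :=
  forall V : nat -> world F -> Prop, model_valid (Model V) A.

Definition Mod (S : Type) (L : set (form S)) : set (model S) :=
  [set M | forall A, L A -> model_valid M A].

Definition Fr (S : Type) (L : set (form S)) : set (frame S) :=
  [set F | forall A, L A -> frame_valid F A].

Definition logic_of (S : Type) (C : set (frame S)) : set (form S) :=
  [set A | forall F, C F -> frame_valid F A].

Definition finite_frame (S : Type) (F : frame S) : Prop :=
  finite_set [set: world F].

(** In a tautology, variables and boxed formulas are the propositional atoms. *)
Fixpoint truth_value (S : Type) (v : form S -> bool) (A : form S) : bool :=
  match A with
  | Bot => false
  | Imp A B => truth_value v A ==> truth_value v B
  | Var _ | Box _ _ => v A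
  end.

Definition tautology (S : Type) (A : form S) : Prop :=
  forall v : form S -> bool, truth_value v A.

Definition axiomK (S : Type) (e : S) : form S :=
  Imp (Box e (Imp (Var 0) (Var 1))) (Imp (Box e (Var 0)) (Box e (Var 1))).

Record normal_logic (S : Type) (L : set (form S)) : Prop := NormalLogic {
  normal_taut : forall A, tautology A -> L A;
  normal_K : forall e, L (axiomK e);
  normal_mp : forall A B, L (Imp A B) -> L A -> L B;
  normal_subst : forall s A, L A -> L (subst s A);
  normal_nec : forall e A, L A -> L (Box e A)
}.

Definition kripke_complete (S : Type) (L : set (form S)) : Prop :=
  exists C : set (frame S), L = logic_of C.

Definition finite_model_property (S : Type) (L : set (form S)) : Prop :=
  exists C : set (frame S),
    (forall F, C F -> finite_frame F) /\ L = logic_of C.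

(** The unimodal language is [form unit]. *)

Record canonical_point (L x : set (form unit)) : Prop := CanonicalPoint {
  canonical_consistent : ~ x Bot;
  canonical_complete : forall A, x A \/ x (Neg A);
  canonical_contains : L `<=` x;
  canonical_mp : forall A B, x (Imp A B) -> x A -> x B
}.

Definition canonical_world (L : set (form unit)) : Type :=
  {x : form unit -> Prop | canonical_point L x}.

Definition canonical_frame (L : set (form unit))
    (ne : inhabited (canonical_world L)) : frame unit :=
  Frame ne (fun _ x y => forall A, sval x (Box tt A) -> sval y A).

(** [canonical_world L] is inhabited exactly when [L] is consistent
    (Lindenbaum), so [ne] plays the role of consistency of [L]; an inconsistent
    [L] has no canonical frame and counts as canonical. *)
Definition canonical_logic (L : set (form unit)) : Prop :=
  forall ne : inhabited (canonical_world L), Fr L (canonical_frame ne).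

Inductive bimodality : Type := mbox | mboxplus.

Definition boxplus_axioms : set (form bimodality) :=
  let p := Var 0 in
  [set A | A = Imp (Box mboxplus p) (Box mbox p)
        \/ A = Imp (Box mboxplus p) (Box mbox (Box mboxplus p))
        \/ A = Imp (Box mboxplus (Imp p (Box mbox p)))
                   (Imp (Box mbox p) (Box mboxplus p))].

Definition boxplus_logic (L : set (form unit)) : set (form bimodality) :=
  smallest (@normal_logic bimodality)
    (rename_modality (fun _ : unit => mbox) @` L `|` boxplus_axioms).

Definition quotient (W : Type) (r : W -> W -> Prop) : Type :=
  {X : W -> Prop | exists x, X = r x}.

Definition class_of (W : Type) (r : W -> W -> Prop) (x : W) : quotient r :=
  exist _ (r x) (ex_intro _ x erefl).

Lemma quotient_nonempty (W : Type) (r : W -> W -> Prop) :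
  inhabited W -> inhabited (quotient r).
Proof. by case=> x; exists; exact: class_of x. Qed.

Definition formula_equiv (S : Type) (M : model S) (Phi : set (form S))
    (x y : world (frame_of M)) : Prop :=
  forall A, Phi A -> (sat x A <-> sat y A).

Definition min_rel (S : Type) (M : model S)
    (r : world (frame_of M) -> world (frame_of M) -> Prop) (e : S)
    (x y : world (frame_of M)) : Prop :=
  exists x' y', r x' x /\ r y' y /\ acc e x' y'.

Definition max_rel (S : Type) (M : model S) (G : set (form S)) (e : S)
    (x y : world (frame_of M)) : Prop :=
  forall A, G (Box e A) -> sat x (Box e A) -> sat y A.

Record filtration (S : Type) (G : set (form S)) (M : model S) : Type :=
  Filtration {
  filt_eq : world (frame_of M) -> world (frame_of M) -> Prop;
  filt_equivalence : Equivalence filt_eq;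
  filt_finite : finite_set [set: quotient filt_eq];
  filt_refines : forall x y, filt_eq x y -> formula_equiv G x y;
  filt_acc : S -> quotient filt_eq -> quotient filt_eq -> Prop;
  filt_val : nat -> quotient filt_eq -> Prop;
  filt_valP : forall p x,
    G (Var p) -> (filt_val p (class_of filt_eq x) <-> valuation M p x);
  filt_min : forall e x y, min_rel filt_eq e x y ->
    filt_acc e (class_of filt_eq x) (class_of filt_eq y);
  filt_max : forall e x y,
    filt_acc e (class_of filt_eq x) (class_of filt_eq y) -> max_rel G e x y
}.

Definition filtration_model (S : Type) (G : set (form S)) (M : model S)
    (f : filtration G M) : model S :=
  @Model S (Frame (quotient_nonempty (@filt_eq S G M f)
                     (world_nonempty (frame_of M))) (@filt_acc S G M f))
         (@filt_val S G M f).

Definition definable (S : Type) (G : set (form S)) (M : model S)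
    (f : filtration G M) : Prop :=
  exists Phi : set (form S), finite_set Phi /\
    forall x y, filt_eq f x y <-> formula_equiv Phi x y.

Definition models_admit_definable_filtration (S : Type)
    (C : set (model S)) : Prop :=
  forall (G : set (form S)) (M : model S),
    finite_set G -> sub_closed G -> C M ->
    exists f : filtration G M, definable f /\ C (filtration_model f).

Definition frames_admit_definable_filtration (S : Type)
    (C : set (frame S)) : Prop :=
  forall (G : set (form S)) (M : model S),
    finite_set G -> sub_closed G -> C (frame_of M) ->
    exists f : filtration G M, definable f /\ C (frame_of (filtration_model f)).

(* Main.v *)
Require Import Defs.
From Stdlib Require Import RelationClasses.
From Stdlib Require Import Relation_Operators Operators_Properties.
From mathcomp Require Import all_boot.
From mathcomp Require Import boolp classical_sets cardinality.

Set Implicit Arguments.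
Unset Strict Implicit.
Unset Printing Implicit Defensive.

Local Open Scope classical_set_scope.

(** Write [R] for the relation of the box and [S] for that of boxplus.

    Models to frames in the unimodal case ([canonical_filtration]). Let [M] be
    a model of [L] and [T] the set of formulas true throughout [M]. The
    canonical frame of [T] is a generated subframe of the canonical frame of
    [L], so it validates [L] because [L] is canonical; hence the canonical
    model of [T] has a definable filtration whose frame validates [L]. Mapping
    a point of [M] to the set of formulas true at it preserves truth. It hits
    every class of that filtration: a class is the extension of some formula
    chi, and if chi failed throughout [M], its negation would be in [T]. So
    the quotient of [M] along this map is the very same finite frame.

    The bimodal case ([boxplus_filtration]). Let [M] be a model of the logic
    with boxplus. Reading every bimodal formula as a fresh variable turns [M]
    into a unimodal model of [L], in which boxplus formulas are atomic. Filter
    it as above through [G] enlarged by the unfoldings of its boxplus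
    formulas, and interpret boxplus by the transitive closure of the filtered
    [R]. The resulting frame validates the axioms for boxplus. The closure
    lies below the maximal relation because the first two axioms propagate the
    unfoldings along [R]-steps. It contains the minimal relation because the
    set of points whose class is reachable from that of [x] is definable, and
    the induction axiom carries its defining formula along [S].

    Completeness. A formula outside the logic fails in the canonical model of
    the logic, hence in the filtration of that model through its subformulas,
    which is based on a finite frame of the logic. *)

(** * Truth and validity *)

Lemma sat_subst (S : Type) (M : model S) (s : nat -> form S)
    (x : world (frame_of M)) (A : form S) :
  sat x (subst s A) <->
  @sat S (Model (fun p y => sat (M := M) y (s p))) x A.
Proof.
elim: A x => [p||A IHA B IHB|e A IH] //= x.
- split=> h /IHA a; exact/IHB/h.
- by split=> h y xy; apply/IH/h.
Qed.

Definition And (S : Type) (A B : form S) : form S := Neg (Imp A (Neg B)).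

Lemma sat_And (S : Type) (M : model S) (x : world (frame_of M)) (A B : form S) :
  sat x (And A B) <-> sat x A /\ sat x B.
Proof.
split=> /= [h|[a b] h]; last exact: h a b.
by split; apply: contrapT => n; apply: h => // a b; exact: n.
Qed.

Lemma sat_tautology (S : Type) (M : model S) (A : form S) :
  tautology A -> model_valid M A.
Proof.
move=> tA x.
have v B : truth_value (fun B => `[< sat x B >]) B = `[< sat x B >].
  elim: B => //= [|B -> C ->]; first by symmetry; apply/asboolP.
  by apply/implyP/asboolP => h /asboolP b; apply/asboolP/h.
by apply/asboolP; rewrite -v.
Qed.

(** Injectivity makes every valuation on [F] the pullback of one on [F'];
    an injective bounded morphism is an isomorphism onto a generated
    subframe. *)
Lemma frame_valid_embedding (S : Type) (F F' : frame S)
    (h : world F -> world F') (A : form S) :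
  injective h ->
  (forall e x y, acc e x y -> acc e (h x) (h y)) ->
  (forall e x z, acc e (h x) z -> exists2 y, h y = z & acc e x y) ->
  frame_valid F' A -> frame_valid F A.
Proof.
move=> h_inj forth back F'A V x.
pose V' p z := exists2 y, h y = z & V p y.
suff satE : forall B y, @sat S (Model V') (h y) B <-> @sat S (Model V) y B.
  exact/satE/F'A.
elim=> [p||B IHB C IHC|e B IH] //= y.
- split=> [[z /h_inj <- //]|Vy]; by exists y.
- split=> hBC /IHB b; exact/IHC/hBC.
- split=> [hB z yz|hB z /back [w <- yw]]; last exact/IH/hB.
  exact/IH/hB/forth.
Qed.

Lemma normal_frame_logic (S : Type) (F : frame S) :
  normal_logic [set A | frame_valid F A].
Proof.
split=> [A tA V|e V x|A B AB a V x|s A a V x|e A a V x y _] /=.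
- exact: sat_tautology.
- by move=> ab a y xy; apply: ab (a y xy).
- exact: (AB V x (a V x)).
- exact/sat_subst/a.
- exact: a.
Qed.

(** * Maximal consistent sets *)

(** What the canonical model construction uses of a normal logic. Closure under
    substitution is left out so that the set of formulas true throughout a
    model is a theory. *)
Record theory (S : Type) (T : set (form S)) : Prop := Theory {
  theory_taut : forall A, tautology A -> T A;
  theory_K : forall e A B,
    T (Imp (Box e (Imp A B)) (Imp (Box e A) (Box e B)));
  theory_mp : forall A B, T (Imp A B) -> T A -> T B;
  theory_nec : forall e A, T A -> T (Box e A)
}.

Lemma normal_theory (S : Type) (L : set (form S)) :
  normal_logic L -> theory L.
Proof.
move=> nL; split; [exact: normal_taut|move=> e A B|
  exact: normal_mp|exact: normal_nec].
exact: (normal_subst nL (fun p => if p is 0 then A else B) (normal_K nL e)).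
Qed.

Lemma model_theory (S : Type) (M : model S) : theory [set A | model_valid M A].
Proof.
split=> [A|e A B x AB a y xy|A B AB a x|e A a x y _] /=.
- exact: sat_tautology.
- exact: AB (a y xy).
- exact: AB (a x).
- exact: a.
Qed.

Definition deductive (S : Type) (T X : set (form S)) : Prop :=
  T `<=` X /\ forall A B, X (Imp A B) -> X A -> X B.

Record maximal (S : Type) (T x : set (form S)) : Prop := Maximal {
  maximal_consistent : ~ x Bot;
  maximal_complete : forall A, x A \/ x (Neg A);
  maximal_deductive : deductive T x
}.

Section Lindenbaum.
Variables (S : Type) (T : set (form S)).
Hypothesis theoryT : theory T.

Lemma deductive_taut X A : deductive T X -> tautology A -> X A.
Proof. by move=> [TX _] tA; apply: TX; exact: theory_taut. Qed.

(** By the deduction theorem this is the closure of [X] with [A] added, so no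
    derivations have to be handled. *)
Lemma deductive_add X A :
  deductive T X -> deductive T [set B | X (Imp A B)].
Proof.
move=> dX; have [TX mpX] := dX; split=> [B TB|B C ABC AB] /=.
  apply: (mpX) (TX _ TB); apply: deductive_taut => // v /=.
  by do !case: (truth_value _ _).
apply: (mpX) AB; apply: (mpX) ABC; apply: deductive_taut => // v /=.
by do !case: (truth_value _ _).
Qed.

Lemma sub_deductive_add X A : deductive T X -> X `<=` [set B | X (Imp A B)].
Proof.
move=> dX B XB; apply: (dX.2) XB; apply: deductive_taut => // v /=.
by do !case: (truth_value _ _).
Qed.

Lemma mem_deductive_add X A : deductive T X -> X (Imp A A).
Proof.
by move=> dX; apply: deductive_taut => // v /=; case: (truth_value _ _).
Qed.

Lemma maximal_extension X : deductive T X -> ~ X Bot ->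
  exists2 x, maximal T x & X `<=` x.
Proof.
move=> dX cX.
(* The union with X lets the empty chain be bounded. *)
pose P Y := deductive T (X `|` Y) /\ ~ (X `|` Y) Bot.
have [|Y [[dY cY] maxY]] := @Zorn_bigcup _ P.
  move=> C CP totC; split; last first.
    by case=> [//|[Y CY YBot]]; case: (CP _ CY) => _; apply; right.
  split=> [A TA|A B]; first by left; apply: dX.1.
  have liftC Y : C Y -> X `|` Y `<=` X `|` \bigcup_(Z in C) Z.
    by move=> CY D [|YD]; [left|right; exists Y].
  case=> [XAB|[Y CY YAB]] [XA|[Z CZ ZA]].
  - by left; apply: dX.2 XA.
  - by apply: (liftC Z CZ); apply: (CP Z CZ).1.2; [left; exact: XAB|right].
  - by apply: (liftC Y CY); apply: (CP Y CY).1.2; [right; exact: YAB|left].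
  - case: (totC Y Z CY CZ) => [YZ|ZY].
    + apply: (liftC Z CZ); apply: (CP Z CZ).1.2; right; [exact: YZ YAB|done].
    + apply: (liftC Y CY); apply: (CP Y CY).1.2; right; [exact: YAB|exact: ZY].
exists (X `|` Y); last by left.
split=> // A; have [|nA] := pselect ((X `|` Y) (Neg A)); [by right|left].
have dXA := deductive_add A dY; have XA := @sub_deductive_add _ A dY.
apply: contrapT => nYA; apply: (maxY [set B | (X `|` Y) (Imp A B)]).
  split=> [|sub]; first by move=> B YB; apply: XA; right.
  by apply: nYA; right; apply: sub; exact: mem_deductive_add dY.
by rewrite /P setUidr // => B XB; apply: XA; left.
Qed.

(** Extend [X] together with the negation of [A]. *)
Lemma maximal_separation X A : deductive T X -> ~ X A ->
  exists2 x, maximal T x & X `<=` x /\ ~ x A.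
Proof.
move=> dX nXA.
have [|x mx sub] := maximal_extension (deductive_add (Neg A) dX).
  move=> /= nnA; apply: nXA; apply: dX.2 nnA; apply: deductive_taut => // v /=.
  by case: (truth_value _ _).
exists x => //; split=> [B XB|xA].
  by apply: sub; exact: sub_deductive_add XB.
apply: (maximal_consistent mx); have [_ mpx] := maximal_deductive mx.
exact: mpx (sub _ (mem_deductive_add _ dX)) xA.
Qed.

Lemma maximal_Imp x A B : maximal T x -> x (Imp A B) <-> (x A -> x B).
Proof.
move=> mx; have [_ mpx] := maximal_deductive mx.
split=> [AB|AB]; first exact: mpx.
have taut := deductive_taut (maximal_deductive mx).
have [xA|xnA] := maximal_complete mx A.
  by apply: (mpx) (AB xA); apply: taut => v /=; do !case: (truth_value _ _).
by apply: (mpx) xnA; apply: taut => v /=; do !case: (truth_value _ _).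
Qed.

End Lindenbaum.

Lemma sat_maximal (S : Type) (M : model S) (x : world (frame_of M))
    (T : set (form S)) :
  T `<=` [set A | model_valid M A] -> maximal T [set A | sat x A].
Proof.
move=> TM; split=> [//|A|]; first exact: EM.
by split=> [A /TM|A B AB]; [exact|exact: AB].
Qed.

(** * The canonical model of a theory *)

Definition canonical_type (S : Type) (T : set (form S)) : Type :=
  {x : form S -> Prop | maximal T x}.

Definition canonical_model (S : Type) (T : set (form S))
    (ne : inhabited (canonical_type T)) : model S :=
  @Model S
    (@Frame S _ ne (fun e x y => forall A, sval x (Box e A) -> sval y A))
    (fun p x => sval x (Var p)).

Lemma truth_lemma (S : Type) (T : set (form S)) (theoryT : theory T)
    (ne : inhabited (canonical_type T))
    (x : world (frame_of (canonical_model ne))) (A : form S) :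
  sat x A <-> sval x A.
Proof.
elim: A x => [p||A IHA B IHB|e A IH] //= x; have mx := svalP x.
- by split=> // /(maximal_consistent mx).
- rewrite (maximal_Imp theoryT _ _ mx); split=> h /IHA a; exact/IHB/h.
split=> [h|xA y xy]; last exact/IH/xy.
apply: contrapT => nxA; have [Tx mpx] := maximal_deductive mx.
have dX : deductive T [set B | sval x (Box e B)].
  split=> [B TB|B C BC b] /=; first by apply: Tx; exact: theory_nec.
  by apply: (mpx) b; apply: (mpx) BC; apply: Tx; exact: theory_K.
have [y my [xy nyA]] := maximal_separation theoryT dX nxA.
by apply: nyA; apply/(IH (exist _ y my))/h.
Qed.

Lemma canonical_inhabited (S : Type) (T : set (form S)) (A : form S) :
  theory T -> ~ T A -> inhabited (canonical_type T).
Proof.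
move=> thT nTA; have dT : deductive T T by split=> //; exact: theory_mp.
by have [x mx _] := maximal_separation thT dT nTA; exists; exists x.
Qed.

Lemma canonical_refutes (S : Type) (T : set (form S)) (A : form S)
    (thT : theory T) (ne : inhabited (canonical_type T)) :
  ~ T A -> exists x : world (frame_of (canonical_model ne)), ~ sat x A.
Proof.
move=> nTA; have dT : deductive T T by split=> //; exact: theory_mp.
have [x mx [_ nxA]] := maximal_separation thT dT nTA.
by exists (exist _ x mx); rewrite truth_lemma.
Qed.

Lemma canonical_valid (S : Type) (T : set (form S)) (thT : theory T)
    (ne : inhabited (canonical_type T)) :
  Mod T (canonical_model ne).
Proof.
move=> A TA x; apply/(truth_lemma thT).
by have [Tx _] := maximal_deductive (svalP x); exact: Tx.
Qed.

(** The maximal sets containing [T] form a generated subframe of the canonical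
    frame of [L], because [T] is closed under necessitation. *)
Lemma canonical_frame_theory (L T : set (form unit))
    (ne : inhabited (canonical_type T)) :
  canonical_logic L -> L `<=` T -> theory T ->
  Fr L (frame_of (canonical_model ne)).
Proof.
move=> canL LT thT A LA.
have pt (x : canonical_type T) : canonical_point L (sval x).
  have [cx fx [Tx mpx]] := svalP x.
  by split=> //; exact: subset_trans Tx.
pose h x : canonical_world L := exist _ (sval x) (pt x).
have neL : inhabited (canonical_world L) by case: ne => x; exists; exact: h.
apply: (@frame_valid_embedding _ (frame_of (canonical_model ne))
          (canonical_frame neL) h A _ _ _ (canL neL A LA)).
- by move=> [x mx] [y my] /= [xy]; exact: eq_exist.
- by case.
- move=> [] x [z zL] /= xz.
  have [Tx _] := maximal_deductive (svalP x).
  have mz : maximal T z.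
    have [cz fz Lz mpz] := zL; split=> //; split=> // B TB.
    apply: xz; apply: (Tx); exact: theory_nec.
  exists (exist _ z mz) => //; exact: eq_exist.
Qed.

(** * Quotients and filtrations *)

Lemma class_of_surj (W : Type) (r : W -> W -> Prop) (c : quotient r) :
  exists x, c = class_of r x.
Proof. by case: c => X [x eX]; exists x; exact: eq_exist. Qed.

Lemma class_of_eq (W : Type) (r : W -> W -> Prop) (x y : W) :
  Equivalence r -> class_of r x = class_of r y <-> r x y.
Proof.
move=> eqr; split=> [[->]|xy]; first reflexivity.
apply: eq_exist; apply/funext => z; apply/propext.
split=> h; last by transitivity y.
by transitivity x => //; symmetry.
Qed.

(** The unions of classes of [formula_equiv Phi] are definable: split
    according to the truth of each member of [Phi] in turn. *)
Lemma invariant_definable (S : Type) (M : model S) (Phi : set (form S))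
    (P : world (frame_of M) -> Prop) :
  finite_set Phi -> (forall x y, formula_equiv Phi x y -> P x -> P y) ->
  exists chi, forall x, sat x chi <-> P x.
Proof.
move=> /(@finite_seqP {classic form S}) [s ->]; elim: s P => [|A s IH] P invP.
  have [[x Px]|nP] := pselect (exists x, P x).
    exists (Neg Bot) => y; split=> [_|_ []]; apply: (invP x y _ Px) => B.
    by rewrite /= in_nil.
  by exists Bot => y; split=> // Py; apply: nP; exists y.
(* The part of P where A has the truth value b, saturated for s. *)
pose Q (b : Prop) y := exists x, [/\ P x, sat x A <-> b &
  formula_equiv (M := M) [set` (s : seq {classic form S})] x y].
have [b|chi1 chi1P] := IH (Q True).
  move=> y xy [x [Px xA sx]]; exists x; split=> // B sB.
  by rewrite -(xy B sB); exact: sx.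
have [b|chi0 chi0P] := IH (Q False).
  move=> y xy [x [Px xA sx]]; exists x; split=> // B sB.
  by rewrite -(xy B sB); exact: sx.
have QE b y : (sat y A <-> b) -> Q b y <-> P y.
  move=> yA; split=> [[x [Px xA sx]]|Py]; last by exists y.
  apply: (invP x y _ Px) => B /=; rewrite in_cons => /orP[/eqP ->|/sx //].
  by rewrite xA yA.
exists (And (Imp A chi1) (Imp (Neg A) chi0)) => y.
rewrite sat_And /= chi1P chi0P; have [yA|nyA] := pselect (sat y A).
  rewrite QE; last by split.
  by split=> [[] /(_ yA)|Py].
rewrite (QE False) //; split=> [[_] /(_ nyA)//|Py].
by split.
Qed.

Lemma filtration_lemma (S : Type) (G : set (form S)) (M : model S)
    (f : filtration G M) (A : form S) (x : world (frame_of M)) :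
  sub_closed G -> G A ->
  @sat S (filtration_model f) (class_of (filt_eq f) x) A <-> sat x A.
Proof.
move=> subG; elim: A x => [p||A IHA B IHB|e A IH] //= x GA.
- exact: filt_valP.
- have GA' : G A by apply: subG GA _; right; left; case: (A) => *; left.
  have GB : G B by apply: subG GA _; right; right; case: (B) => *; left.
  by split=> h /(IHA x GA') a; apply/(IHB x GB)/h.
have GA' : G A by apply: subG GA _; right; case: (A) => *; left.
split=> [h y xy|h c].
  apply/(IH y GA')/h; apply: filt_min; exists x, y.
  by have eqf := filt_equivalence f; split; [reflexivity|split; [reflexivity|]].
have [y ->] := class_of_surj c => xy; apply/(IH y GA').
exact: filt_max xy A GA h.
Qed.

(** The filtration is taken on the canonical model of the theory of [M], whose
    frame validates [L], and transported to [M]; nothing is lost because every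
    class contains the image of a point of [M]. *)
Lemma canonical_filtration (L G : set (form unit)) (M : model unit) :
  canonical_logic L -> frames_admit_definable_filtration (Fr L) ->
  Mod L M -> finite_set G -> sub_closed G ->
  exists f : filtration G M,
    definable f /\ Fr L (frame_of (filtration_model f)).
Proof.
move=> canL filtL ML finG subG.
pose T := [set A | model_valid M A]; have thT : theory T := model_theory M.
pose h (x : world (frame_of M)) : canonical_type T :=
  exist _ [set A | sat x A] (sat_maximal x (@subset_refl _ T)).
have ne : inhabited (canonical_type T).
  by case: (world_nonempty (frame_of M)) => x; exists; exact: h.
pose N := canonical_model ne.
have hP x A : @sat _ N (h x) A <-> sat x A by rewrite (truth_lemma thT).
have FN : Fr L (frame_of N) by exact: canonical_frame_theory.
have [fN [[Phi [finPhi PhiP]] FfN]] := filtL G N finG subG FN.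
have eqN := filt_equivalence fN.
pose r x y := filt_eq fN (h x) (h y).
have eqr : Equivalence r.
  split=> [x|x y|x y z]; rewrite /r; first reflexivity.
    by move=> xy; symmetry.
  by move=> xy yz; transitivity (h y).
have [g gP] : exists g : quotient r -> quotient (filt_eq fN),
    forall x, g (class_of r x) = class_of _ (h x).
  have [c|g gP] := @choice (quotient r) (quotient (filt_eq fN))
      (fun c d => forall x, c = class_of r x -> d = class_of _ (h x)).
    have [x ->] := class_of_surj c; exists (class_of _ (h x)) => y.
    by move=> /(class_of_eq _ _ eqr) xy; apply/class_of_eq.
  by exists g => x; exact: gP.
have g_inj : injective g.
  move=> c d; have [x ->] := class_of_surj c; have [y ->] := class_of_surj d.
  by rewrite !gP => /(class_of_eq _ _ eqN) xy; apply/class_of_eq.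
(* A class of the filtration is defined by a formula chi; if no h x were in
   it, the negation of chi would belong to the theory of M. *)
have g_surj d : exists c, g c = d.
  have [y ->] := class_of_surj d.
  have [u v uv|chi chiP] := @invariant_definable _ N Phi (filt_eq fN y) finPhi.
    by move=> yu; transitivity u => //; apply/PhiP.
  have [[x xchi]|nx] := pselect (exists x, sat (M := M) x chi).
    exists (class_of r x); rewrite gP; apply/class_of_eq => //.
    by symmetry; apply/chiP/hP.
  have Tnchi : T (Neg chi) by move=> x xchi; apply: nx; exists x.
  have := canonical_valid (ne := ne) thT Tnchi y.
  by case; apply/chiP; reflexivity.
have [ginv ginvP] := choice g_surj.
have finr : finite_set [set: quotient r].
  apply: sub_finite_set (finite_image ginv (filt_finite fN)) => c _.
  by exists (g c) => //; apply: g_inj; rewrite ginvP.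
have refr x y : r x y -> formula_equiv G x y.
  by move=> rxy A GA; have := filt_refines rxy GA; rewrite !hP.
pose accr e c d := filt_acc (f := fN) e (g c) (g d).
pose valr p c := filt_val (f := fN) p (g c).
have valrP p x : G (Var p) -> valr p (class_of r x) <-> valuation M p x.
  by move=> /filt_valP; rewrite /valr gP => ->; exact: (hP x (Var p)).
have minr e x y : min_rel r e x y -> accr e (class_of r x) (class_of r y).
  move=> [x' [y' [xx [yy xy]]]]; rewrite /accr !gP; apply: filt_min.
  exists (h x'), (h y'); split=> //; split=> // A; case: e xy => xy.
  by apply.
have maxr e x y : accr e (class_of r x) (class_of r y) -> max_rel G e x y.
  rewrite /accr !gP => cd A GA xA; apply/hP/(filt_max cd GA).
  exact/(hP x (Box e A)).
pose f := Filtration eqr finr refr valrP minr maxr; exists f; split.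
  exists Phi; split=> // x y; rewrite /= /r PhiP.
  by split=> xy A PhiA; have := xy A PhiA; rewrite !hP.
move=> A LA.
apply: (@frame_valid_embedding _ (frame_of (filtration_model f))
          (frame_of (filtration_model fN)) g A _ _ _ (FfN A LA)) => //=.
move=> e c d cd.
by have [d' d'P] := g_surj d; exists d' => //; rewrite /accr d'P.
Qed.

(** * The logic with a transitive closure modality *)

Lemma boxplus_normal (L : set (form unit)) : normal_logic (boxplus_logic L).
Proof.
split=> [A tA|e|A B AB a|s A a|e A a] X [nX subX].
- exact: normal_taut.
- exact: normal_K.
- exact: normal_mp nX _ _ (AB X (conj nX subX)) (a X (conj nX subX)).
- exact: normal_subst nX _ _ (a X (conj nX subX)).
- exact: normal_nec nX _ _ (a X (conj nX subX)).
Qed.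

Lemma sat_boxplus_axioms (L : set (form unit)) (M : model bimodality)
    (A : form bimodality) (x : world (frame_of M)) :
  Mod (boxplus_logic L) M ->
  [/\ sat x (Imp (Box mboxplus A) (Box mbox A)),
      sat x (Imp (Box mboxplus A) (Box mbox (Box mboxplus A))) &
      sat x (Imp (Box mboxplus (Imp A (Box mbox A)))
                 (Imp (Box mbox A) (Box mboxplus A)))].
Proof.
move=> ML; have inst B : boxplus_axioms B -> sat x (subst (fun=> A) B).
  move=> axB; apply: ML; apply: (normal_subst (boxplus_normal L)).
  by apply: sub_gen_smallest; right.
split; [apply: (inst (Imp (Box mboxplus (Var 0)) (Box mbox (Var 0))))
  | apply: (inst (Imp (Box mboxplus (Var 0)) (Box mbox (Box mboxplus (Var 0)))))
  | apply: (inst (Imp (Box mboxplus (Imp (Var 0) (Box mbox (Var 0))))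
                      (Imp (Box mbox (Var 0)) (Box mboxplus (Var 0)))))].
- by left.
- by right; left.
- by right; right.
Qed.

Definition reduct (F : frame bimodality) : frame unit :=
  Frame (world_nonempty F) (fun _ => @acc _ F mbox).

Lemma sat_rename (F : frame bimodality) (V : nat -> world F -> Prop)
    (x : world F) (A : form unit) :
  @sat _ (Model V) x (rename_modality (fun=> mbox) A) <->
  @sat _ (@Model _ (reduct F) V) x A.
Proof.
elim: A x => [p||A IHA B IHB|e A IH] //= x.
- split=> h /IHA a; exact/IHB/h.
- by split=> h y xy; apply/IH/h.
Qed.

(** The induction axiom holds because a path of the closure can be followed
    one step at a time from its source. *)
Lemma transitive_closure_frame (L : set (form unit)) (F : frame bimodality) :
  Fr L (reduct F) ->
  (forall x y : world F,
     acc mboxplus x y <-> clos_trans _ (acc mbox) x y) ->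
  Fr (boxplus_logic L) F.
Proof.
move=> FL plusE A LA; apply: (LA [set B | frame_valid F B]).
split=> [|B [[C LC <-]|]]; first exact: normal_frame_logic.
  by move=> V x; apply/sat_rename/FL.
case=> [->|[->|->]] V x /=.
- by move=> xp y xy; apply/xp/plusE; exact: t_step.
- move=> xp y xy z /plusE yz; apply/xp/plusE.
  by apply: t_trans yz; exact: t_step.
move=> step xp y /plusE/clos_trans_tn1_iff; elim=> [z /xp //|z w zw xz zp].
by apply: step zp _ zw; apply/plusE/clos_trans_tn1_iff.
Qed.

Fixpoint form_tree (A : form bimodality) : GenTree.tree nat :=
  match A with
  | Var p => GenTree.Leaf p
  | Bot => GenTree.Node 0 [::]
  | Imp A B => GenTree.Node 1 [:: form_tree A; form_tree B]
  | Box mbox A => GenTree.Node 2 [:: form_tree A]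
  | Box mboxplus A => GenTree.Node 3 [:: form_tree A]
  end.

Fixpoint tree_form (t : GenTree.tree nat) : form bimodality :=
  match t with
  | GenTree.Leaf p => Var p
  | GenTree.Node 1 [:: s; t] => Imp (tree_form s) (tree_form t)
  | GenTree.Node 2 [:: t] => Box mbox (tree_form t)
  | GenTree.Node 3 [:: t] => Box mboxplus (tree_form t)
  | GenTree.Node _ _ => Bot
  end.

Lemma form_treeK : cancel form_tree tree_form.
Proof. by elim=> //= [A -> B ->|[] A /= ->]. Qed.

(** The coding is known only through this opaque existence statement, so that
    no conversion test ever evaluates a unary code. *)
Lemma form_coding :
  exists c : (form bimodality -> nat) * (nat -> form bimodality),
    cancel c.1 c.2.
Proof.
exists (pickle \o form_tree, fun n => oapp tree_form Bot (unpickle n)) => A /=.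
by rewrite pickleK /= form_treeK.
Qed.

Definition encode : form bimodality -> nat := (sval (cid form_coding)).1.

Definition decode : nat -> form bimodality := (sval (cid form_coding)).2.

Lemma encodeK : cancel encode decode.
Proof. exact: svalP (cid form_coding). Qed.

Fixpoint flatten_boxplus (A : form bimodality) : form unit :=
  match A with
  | Var p => Var (encode (Var p))
  | Bot => Bot
  | Imp A B => Imp (flatten_boxplus A) (flatten_boxplus B)
  | Box mbox A => Box tt (flatten_boxplus A)
  | Box mboxplus A => Var (encode (Box mboxplus A))
  end.

(** Left inverse of [flatten_boxplus]. Being a substitution instance of the
    renamed formula, it sends [L] into the logic with boxplus. *)
Definition unflatten (A : form unit) : form bimodality :=
  subst decode (rename_modality (fun=> mbox) A).

Definition flat_model (M : model bimodality) : model unit :=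
  @Model _ (reduct (frame_of M)) (fun q x => sat (M := M) x (decode q)).

Lemma sat_unflatten (M : model bimodality) (x : world (frame_of M))
    (A : form unit) :
  sat x (unflatten A) <-> @sat _ (flat_model M) x A.
Proof. by rewrite sat_subst sat_rename. Qed.

Lemma sat_flatten (M : model bimodality) (x : world (frame_of M))
    (A : form bimodality) :
  @sat _ (flat_model M) x (flatten_boxplus A) <-> sat x A.
Proof.
elim: A x => [p||A IHA B IHB|[] A IH] x.
- by rewrite /= encodeK.
- by [].
- by split=> h /IHA a; exact/IHB/h.
- by split=> h y xy; apply/IH/h.
- by rewrite /= encodeK.
Qed.

Lemma flat_model_valid (L : set (form unit)) (M : model bimodality) :
  Mod (boxplus_logic L) M -> Mod L (flat_model M).
Proof.
move=> ML A LA x; apply/sat_unflatten/ML.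
apply: (normal_subst (boxplus_normal L)); apply: sub_gen_smallest.
by left; exists A.
Qed.

Lemma subformula_refl (S : Type) (A : form S) : subformula A A.
Proof. by case: A => *; left. Qed.

Lemma subformula_trans (S : Type) (A B C : form S) :
  subformula A B -> subformula B C -> subformula A C.
Proof.
move=> AB; elim: C => [p||C IHC D IHD|e C IH] /= [BC|//];
  try by rewrite BC in AB.
- by case=> [/IHC|/IHD] h; right; [left|right].
- by move/IH; right.
Qed.

Lemma finite_subformula (S : Type) (A : form S) :
  finite_set [set B | subformula B A].
Proof.
elim: A => [p||A IHA B IHB|e A IH] /=.
- by apply: sub_finite_set (finite_set1 (Var p)) => B [->|].
- by apply: sub_finite_set (finite_set1 Bot) => B [->|].
- apply: (@sub_finite_set _ _ ([set Imp A B] `|`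
    ([set C | subformula C A] `|` [set C | subformula C B]))).
    by move=> C [->|h]; [left|right].
  by rewrite !finite_setU; split; [exact: finite_set1|].
apply: (@sub_finite_set _ _ ([set Box e A] `|` [set C | subformula C A])).
  by move=> C [->|h]; [left|right].
by rewrite !finite_setU; split; [exact: finite_set1|].
Qed.

Lemma subformula_flatten (A : form bimodality) (C : form unit) :
  subformula C (flatten_boxplus A) ->
  exists2 B, subformula B A & C = flatten_boxplus B.
Proof.
elim: A => [p||A IHA B IHB|[] A IH] /=.
- by case=> // ->; exists (Var p) => //; left.
- by case=> // ->; exists Bot => //; left.
- case=> [->|[/IHA|/IHB] [D DA ->]]; first by exists (Imp A B) => //; left.
    by exists D => //; right; left.
  by exists D => //; right; right.
- case=> [->|/IH [D DA ->]]; first by exists (Box mbox A) => //; left.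
  by exists D => //; right.
- by case=> // ->; exists (Box mboxplus A) => //; left.
Qed.

(** One step of the fixpoint unfolding of boxplus: in a model of the logic, a
    filtration of the box through these formulas carries both [A] and
    [Box mboxplus A] along every step out of a point where [Box mboxplus A]
    holds. *)
Definition unfold_boxplus (G : set (form bimodality)) :
    set (form bimodality) :=
  G `|` ((Box mbox @` [set A | G (Box mboxplus A)]) `|`
    (Box mbox \o Box mboxplus) @` [set A | G (Box mboxplus A)]).

Lemma finite_unfold_boxplus (G : set (form bimodality)) :
  finite_set G -> finite_set (unfold_boxplus G).
Proof.
move=> finG; suff fin : finite_set [set A | G (Box mboxplus A)].
  by rewrite !finite_setU; do !split=> //; exact: finite_image.
apply: sub_finite_set
  (finite_image (fun A => if A is Box _ B then B else Bot) finG) => A GA.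
by exists (Box mboxplus A).
Qed.

Lemma sub_closed_unfold_boxplus (G : set (form bimodality)) :
  sub_closed G -> sub_closed (unfold_boxplus G).
Proof.
move=> subG A B [GA|[[C GC <-]|[C GC <-]]].
- by move=> BA; left; exact: subG BA.
- case=> [->|BC]; first by right; left; exists C.
  by left; apply: subG GC _; right.
- case=> [->|BC]; first by right; right; exists C.
  by left; apply: subG GC _.
Qed.

(** Filter the flattened model for the box, then close transitively for
    boxplus. *)
Lemma boxplus_filtration (L : set (form unit)) (G : set (form bimodality))
    (M : model bimodality) :
  canonical_logic L -> frames_admit_definable_filtration (Fr L) ->
  Mod (boxplus_logic L) M -> finite_set G -> sub_closed G ->
  exists f : filtration G M,
    definable f /\ Fr (boxplus_logic L) (frame_of (filtration_model f)).
Proof.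
move=> canL filtL ML finG subG.
pose G' := flatten_boxplus @` unfold_boxplus G.
have finG' : finite_set G'.
  exact/finite_image/finite_unfold_boxplus.
have subG' : sub_closed G'.
  move=> _ C [A GA <-] /subformula_flatten [B BA ->]; exists B => //.
  exact: sub_closed_unfold_boxplus GA BA.
have [f [[Phi [finPhi PhiP]] Ff]] :=
  canonical_filtration canL filtL (flat_model_valid ML) finG' subG'.
have GG' A : G A -> G' (flatten_boxplus A) by move=> GA; exists A => //; left.
have eqf := filt_equivalence f.
pose W := world (frame_of M).
pose r : W -> W -> Prop := filt_eq f.
pose Rbox : quotient r -> quotient r -> Prop := filt_acc (f := f) tt.
pose R (e : bimodality) :=
  if e is mbox then Rbox else clos_trans (quotient r) Rbox.
pose V p (c : quotient r) := filt_val (f := f) (encode (Var p)) c.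
have refr x y : r x y -> formula_equiv G x y.
  by move=> rxy A GA; have := filt_refines rxy (GG' A GA); rewrite !sat_flatten.
have VP p x : G (Var p) -> V p (class_of r x) <-> valuation M p x.
  by move=> /GG'/filt_valP; rewrite /V => ->; rewrite /= encodeK.
have boxR x y : acc mbox x y -> Rbox (class_of r x) (class_of r y).
  by move=> xy; apply: filt_min; exists x, y; split; [|split];
    [reflexivity|reflexivity|].
have plusR x y : acc mboxplus x y -> R mboxplus (class_of r x) (class_of r y).
  have [u v uv|chi chiP] := @invariant_definable _ (flat_model M) Phi
      (fun z => R mboxplus (class_of r x) (class_of r z)) finPhi.
    suff -> : class_of r u = class_of r v by [].
    by apply/class_of_eq => //; exact/PhiP.
  have [_ _ ind] := sat_boxplus_axioms (unflatten chi) x ML.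
  (* chi holds exactly at the points whose class is reachable from x. *)
  move=> xy; apply/chiP/sat_unflatten; apply: ind xy.
    move=> z _ /sat_unflatten/chiP xz u zu; apply/sat_unflatten/chiP.
    by apply: t_trans xz _; apply: t_step; exact: boxR.
  move=> z xz; apply/sat_unflatten/chiP; apply: t_step; exact: boxR.
have minR e x y : min_rel r e x y -> R e (class_of r x) (class_of r y).
  move=> [x' [y' [/(class_of_eq _ _ eqf) <- [/(class_of_eq _ _ eqf) <-]]]].
  by case: e => [/boxR|/plusR].
have maxbox x y A : unfold_boxplus G (Box mbox A) ->
    Rbox (class_of r x) (class_of r y) -> sat x (Box mbox A) -> sat y A.
  move=> GA cd xA; have G'A : G' (flatten_boxplus (Box mbox A)).
    by exists (Box mbox A).
  apply/sat_flatten/(filt_max cd G'A); exact/(sat_flatten x (Box mbox A)).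
have maxplus A c d : G (Box mboxplus A) -> R mboxplus c d ->
    forall x y, c = class_of r x -> d = class_of r y ->
    sat x (Box mboxplus A) -> sat y A /\ sat y (Box mboxplus A).
  move=> GA; elim=> {c d} [c d cd|c d e _ IH1 _ IH2] x y cE dE xA.
    rewrite {}cE {}dE in cd.
    have [/(_ xA) xA1 /(_ xA) xA2 _] := sat_boxplus_axioms A x ML; split.
      by apply: (maxbox x y A _ cd xA1); right; left; exists A.
    by apply: (maxbox x y (Box mboxplus A) _ cd xA2); right; right; exists A.
  have [z dE'] := class_of_surj d.
  by have [_] := IH1 x z cE dE' xA; exact: IH2.
have maxR e x y : R e (class_of r x) (class_of r y) -> max_rel G e x y.
  case: e => [xy A GA|xy A GA xA]; first by apply: maxbox xy; left.
  by have [] := maxplus A _ _ GA xy x y erefl erefl xA.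
pose f' := @Filtration _ G M r eqf (filt_finite f) refr R V VP minR maxR.
exists f'; split; last first.
  apply: transitive_closure_frame => // A /Ff.
  apply: (@frame_valid_embedding _ (reduct (frame_of (filtration_model f')))
            (frame_of (filtration_model f)) id) => // [[] //|[] c d cd].
  by exists d.
exists (unflatten @` Phi); split; first exact: finite_image.
move=> x y; apply: (iff_trans (PhiP x y)); split=> [xy _ [A PhiA <-]|xy A PhiA].
  by rewrite !sat_unflatten; exact: xy.
by rewrite -!sat_unflatten; apply: xy; exists A.
Qed.

Theorem theorem3p10 (L : set (form unit))
    (L_normal : normal_logic L)
    (L_canonical : canonical_logic L)
    (L_filtration : frames_admit_definable_filtration (Fr L)) :
  models_admit_definable_filtration (Mod (boxplus_logic L)) /\
  finite_model_property (boxplus_logic L) /\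
  kripke_complete (boxplus_logic L).
Proof.
have filt G M := @boxplus_filtration L G M L_canonical L_filtration.
have fmp : finite_model_property (boxplus_logic L).
  exists [set F | finite_frame F /\ Fr (boxplus_logic L) F].
  split=> [F []//|]; apply/seteqP; split=> A; first by move=> LA F [_]; exact.
  move=> validA; apply: contrapT => nLA.
  have thL := normal_theory (boxplus_normal L).
  have ne := canonical_inhabited thL nLA.
  have [x nxA] := canonical_refutes thL ne nLA.
  have subA : sub_closed [set B | subformula B A].
    by move=> B C BA CB; exact: subformula_trans CB BA.
  have [f [_ Ff]] := filt _ _ (canonical_valid (ne := ne) thL)
    (finite_subformula A) subA.
  apply/nxA/(filtration_lemma f x subA (subformula_refl A)).
  by apply: validA; split=> //; exact: filt_finite.
split; last by split=> //; have [C [_ LE]] := fmp; exists C.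
move=> G M finG subG ML; have [f [deff Ff]] := filt G M ML finG subG.
by exists f; split=> // A LA; exact: Ff.
Qed.
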